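(* Suppose that $c_0k^2\leq r=o(n^{1/2})$ for a suitable constant $c_0>0$. Then the algorithm $\mathtt{Decide}_k$, applied to the random regular graph $G_{n,r}$, has polynomial expected running time.
   Context: $G_{n,r}$ denotes an $r$-regular graph on $\{1,\dots,n\}$ chosen uniformly at random. The algorithm $\mathtt{Decide}_k$ on input $G$: (1) compute the vector chromatic number $\bar\vartheta_{1/2}(G)$ (in polynomial time); if $\bar\vartheta_{1/2}(G)>k$, output ''$\chi(G)>k$'' and stop; (2) otherwise compute $\chi(G)$ exactly in time $o(\exp(n))$ (Lawler's algorithm) and answer correctly whether $\chi(G)\leq k$. Here $\bar\vartheta_{1/2}(G)$ is the infimum of $k'>1$ such that there are unit vectors $v_1,\dots,v_n\in\mathbb R^n$ with $\langle v_i,v_j\rangle\leq-1/(k'-1)$ for all edges $\{i,j\}$. Polynomial expected running time means the expected running time over the random input is $O(n^l)$ for some constant $l$. *)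

(* Defs.v *)
From HB Require Import structures.
From mathcomp Require Import all_boot all_order all_algebra.
From mathcomp Require Import classical_sets reals.
From mathcomp Require Import sequences.
Set Implicit Arguments. Unset Strict Implicit. Unset Printing Implicit Defensive.
Import Order.TTheory GRing.Theory Num.Theory.
Local Open Scope ring_scope.
Local Open Scope classical_set_scope.

(* A graph on {1..n} (here 'I_n) is given by its set of ordered pairs (i,j)
   with {i,j} an edge. *)
Definition graph (n : nat) := {set 'I_n * 'I_n}.

Definition simple_graph n (E : graph n) : bool :=
  [forall i : 'I_n, (i, i) \notin E] &&
  [forall i : 'I_n, forall j : 'I_n, ((i, j) \in E) == ((j, i) \in E)].

Definition regular n (r : nat) (E : graph n) : bool :=
  simple_graph E && [forall i : 'I_n, #|[set j : 'I_n | (i, j) \in E]| == r].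

Definition dotv (R : realType) n (u v : 'rV[R]_n) : R := \sum_(i < n) u 0 i * v 0 i.

Definition vec_chrom (R : realType) n (E : graph n) : R :=
  inf [set k' : R | 1 < k' /\
        exists v : 'I_n -> 'rV[R]_n,
          (forall i, dotv (v i) (v i) = 1) /\
          (forall i j, (i, j) \in E -> dotv (v i) (v j) <= - (k' - 1)^-1)].

(* Running time of Decide_k on G, given the cost T1 of step (1) and the cost
   T2 of step (2) (Lawler's algorithm); step (2) is only executed when
   vec_chrom G <= k. *)
Definition decide_time (R : realType) (k : nat)
  (T1 T2 : forall n, graph n -> R) n (E : graph n) : R :=
  T1 n E + (if (k%:R < vec_chrom R E) then 0 else T2 n E).

(* Expected value over G_{n,r}: uniform distribution on r-regular graphs on
   'I_n (defined as 0 when there is no r-regular graph on n vertices). *)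
Definition expect_reg (R : realType) n (r : nat) (f : graph n -> R) : R :=
  (\sum_(E : graph n | regular r E) f E) / #|[set E : graph n | regular r E]|%:R.

(* Main.v *)
Require Import Defs.
From HB Require Import structures.
From mathcomp Require Import all_boot all_order all_algebra.
From mathcomp Require Import classical_sets reals.
From mathcomp Require Import sequences.
From mathcomp Require Import exp ring lra.
Import Order.TTheory GRing.Theory Num.Theory.
Local Open Scope ring_scope.

(* A vector k-colouring gives Gram vectors with
   sum_ij (r/n - A_ij) <v_i, v_j> >= rn/k, so by Grothendieck's inequality (here
   with constant 32) some pair of vertex sets S, U satisfies
   e(S, U) <= r|S||U|/n - delta r n with delta = 1/(64k).  For fixed S and U this
   has probability at most exp(-L), L = delta^2 r n / 16, in G_{n,r}.  Indeed, the
   switchings ab, cd -> ad, cb form an involution, so that the sum over all r-regular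
   E and all switchings of E of w(E') - w(E) vanishes for every weight w, where E' is
   the switched graph.  For w = exp(-theta e(S, U)) the contribution of E is governed
   by the drift 4rn(r|S||U|/n - e(S, U)), up to an error O(r^3 n) from the pairs of
   edges that cannot be switched; hence y = theta (r|S||U|/n - e(S, U) - eta) has
   sum_E y exp(y) <= 0 for a small eta, and y exp(y) >= -1 turns this into the tail
   bound.  The condition r >= c0 k^2 makes L >= 3n, which pays for the 4^n pairs
   (S, U) and for the running time exp(n) of the second step. *)

Set Implicit Arguments.
Unset Strict Implicit.

(** * Grothendieck's inequality, from cut sums to vectors *)

(** Independent random signs on a finite uniform space [W], built by adjoining one fair coin per
    element of [l]. Odd powers of the fresh coin cancel, so the fourth moment grows by c^4 + 6 c^2
    q, less than the growth 3 c^4 + 6 c^2 q of the bound 3 q^2, where q is the sum of squares so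
    far. *)
Lemma rademacher (R : realType) (I : eqType) (l : seq I) : uniq l ->
  exists (W : finType) (s : I -> W -> R),
  [/\ (0 < #|W|)%N,
      forall c c' : I -> R,
        \sum_w (\sum_(i <- l) c i * s i w) * (\sum_(i <- l) c' i * s i w)
        = #|W|%:R * \sum_(i <- l) c i * c' i &
      forall c : I -> R, \sum_w (\sum_(i <- l) c i * s i w) ^+ 4
        <= #|W|%:R * (3%:R * (\sum_(i <- l) c i ^+ 2) ^+ 2)].
Proof.
elim: l => [|x l IHl] /=.
  move=> _; exists unit, (fun _ _ => 0); split; first by rewrite card_unit.
    by move=> c c'; rewrite big1 => [|w _]; rewrite !big_nil ?mulr0.
  by move=> c; rewrite big1 => [|w _]; rewrite !big_nil expr0n//= !mulr0.
case/andP=> xl ul; have [W [s [W0 s2 s4]]] := IHl ul.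
pose t i (p : W * bool) : R := if i == x then (if p.2 then 1 else -1) else s i p.1.
have tE c p : \sum_(i <- x :: l) c i * t i p
    = c x * (if p.2 then 1 else -1) + \sum_(i <- l) c i * s i p.1.
  rewrite big_cons /t eqxx; congr (_ + _).
  apply: eq_big_seq => i il; case: eqP => // ix.
  by rewrite ix in il; rewrite il in xl.
have sumE (F : W * bool -> R) : \sum_p F p = \sum_w (F (w, true) + F (w, false)).
  rewrite (eq_bigr (fun p => F (p.1, p.2))) => [|[]//].
  rewrite -(pair_bigA _ (fun w b => F (w, b)))/=.
  by apply: eq_bigr => w _; rewrite big_bool.
have cW : #|{: W * bool}|%:R = 2 * #|W|%:R :> R.
  by rewrite card_prod card_bool natrM mulrC.
exists (W * bool)%type, t; split.
- by rewrite card_prod card_bool muln_gt0 W0.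
- move=> c c'; rewrite sumE cW big_cons.
  under [X in X = _]eq_bigr => w _ do rewrite !tE/=.
  transitivity (\sum_(w in W) (2 * (c x * c' x)) +
      2 * \sum_w (\sum_(i <- l) c i * s i w) * (\sum_(i <- l) c' i * s i w)).
    rewrite mulr_sumr -big_split/=; apply: eq_bigr => w _; ring.
  by rewrite s2 sumr_const -mulr_natr; ring.
- move=> c; rewrite sumE cW big_cons.
  under [X in X <= _]eq_bigr => w _ do rewrite !tE/=.
  set q := \sum_(i <- l) c i ^+ 2.
  have q0 : 0 <= q by apply: sumr_ge0 => i _; exact: sqr_ge0.
  have q2 : \sum_w (\sum_(i <- l) c i * s i w) ^+ 2 = #|W|%:R * q.
    under eq_bigr => w _ do rewrite expr2.
    by rewrite s2; congr (_ * _); apply: eq_bigr => i _; rewrite expr2.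
  rewrite (_ : \sum_w _ = \sum_(w in W) (2 * (c x) ^+ 4) +
      12 * c x ^+ 2 * \sum_w (\sum_(i <- l) c i * s i w) ^+ 2 +
      2 * \sum_w (\sum_(i <- l) c i * s i w) ^+ 4); last first.
    rewrite !mulr_sumr -!big_split/=; apply: eq_bigr => w _; ring.
  rewrite q2 sumr_const -mulr_natr.
  have := s4 c; rewrite -/q => s4c.
  have W0' : 0 <= #|W|%:R :> R by [].
  have c4 : 0 <= #|W|%:R * c x ^+ 4 by rewrite mulr_ge0// -[4%N]/(2*2)%N exprM sqr_ge0.
  rewrite -subr_ge0.
  rewrite (_ : _ - _ = 2 * (#|W|%:R * (3%:R * q ^+ 2) - \sum_w (\sum_(i <- l) c i * s i w) ^+ 4)
     + 4 * (#|W|%:R * c x ^+ 4)); last by ring.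
  by rewrite addr_ge0// mulr_ge0// subr_ge0.
Qed.

Lemma sum_norm_split (R : realType) (I : finType) (a : I -> R) :
  \sum_i `|a i| = \sum_(i in [set i | 0 <= a i]) a i
                  - \sum_(i in [set i | a i < 0]) a i.
Proof.
rewrite (bigID (fun i => 0 <= a i))/= -sumrN; congr (_ + _).
  by apply: eq_big => [i|i ai]; rewrite ?inE// ger0_norm.
by apply: eq_big => [i|i]; rewrite ?inE -?ltNge// => ai; rewrite ltr0_norm.
Qed.

(** A bilinear form on a box is largest at sign vectors, and each of the two sign vectors is a
    difference of two indicators; this leaves four cut sums. *)
Lemma cut_box (R : realType) (I J : finType) (M : I -> J -> R) (B : R) :
  (forall (S : {set I}) (U : {set J}), `|\sum_(i in S) \sum_(j in U) M i j| <= B) ->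
  forall (x : I -> R) (y : J -> R),
  (forall i, `|x i| <= 1) -> (forall j, `|y j| <= 1) ->
  \sum_i \sum_j M i j * (x i * y j) <= 4 * B.
Proof.
move=> HB x y x1 y1.
have dual (K : finType) (a z : K -> R) : (forall i, `|z i| <= 1) ->
    \sum_i a i * z i <= \sum_i `|a i|.
  move=> z1; apply: ler_sum => i _; apply: le_trans (ler_norm _) _.
  by rewrite normrM ler_piMr.
have key (S : {set I}) : `|\sum_(i in S) \sum_j M i j * y j| <= 2 * B.
  rewrite exchange_big/=.
  have -> : \sum_j \sum_(i in S) M i j * y j = \sum_j (\sum_(i in S) M i j) * y j.
    by apply: eq_bigr => j _; rewrite mulr_suml.
  apply: (@le_trans _ _ (\sum_j `|\sum_(i in S) M i j|)).
    apply: le_trans (ler_norm_sum _ _ _) _; apply: ler_sum => j _.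
    by rewrite normrM ler_piMr.
  rewrite sum_norm_split ![\sum_(i in [set _ | _]) _]exchange_big/=.
  set U1 := [set _ | _]; set U2 := [set _ | _].
  have := HB S U1; have := HB S U2; rewrite !ler_norml; lra.
have -> : \sum_i \sum_j M i j * (x i * y j) = \sum_i (\sum_j M i j * y j) * x i.
  apply: eq_bigr => i _; rewrite mulr_suml; apply: eq_bigr => j _; ring.
apply: le_trans (dual _ _ _ x1) _; rewrite sum_norm_split.
set S1 := [set _ | _]; set S2 := [set _ | _].
have := key S1; have := key S2; rewrite !ler_norml; lra.
Qed.

(** [W] is quantified inside, so that one constant [C] also applies to vectors living on the sample
    space of the random signs. *)
Definition hilbert_bound (R : realType) (I J : finType) (M : I -> J -> R) (C : R) :=
  forall (W : finType) (u : I -> W -> R) (v : J -> W -> R),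
  (forall i, \sum_w u i w ^+ 2 <= 1) -> (forall j, \sum_w v j w ^+ 2 <= 1) ->
  \sum_i \sum_j M i j * (\sum_w u i w * v j w) <= C.

Lemma hilbert_bound_scale (R : realType) (I J : finType) (M : I -> J -> R) (C N : R) :
  0 < N -> hilbert_bound M C ->
  forall (W : finType) (u : I -> W -> R) (v : J -> W -> R),
  (forall i, \sum_w u i w ^+ 2 <= N) -> (forall j, \sum_w v j w ^+ 2 <= N) ->
  \sum_i \sum_j M i j * (\sum_w u i w * v j w) <= N * C.
Proof.
move=> N0 HC W u v hu hv.
pose c := (Num.sqrt N)^-1.
have c2 : c ^+ 2 = N^-1 by rewrite exprVn sqr_sqrtr// ltW.
have cle (K : finType) (z : K -> W -> R) : (forall i, \sum_w z i w ^+ 2 <= N) ->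
    forall i, \sum_w (c * z i w) ^+ 2 <= 1.
  move=> hz i; under eq_bigr => w _ do rewrite exprMn.
  by rewrite -mulr_sumr c2 mulrC ler_pdivrMr// mul1r.
have := HC W (fun i w => c * u i w) (fun j w => c * v j w) (cle _ _ hu) (cle _ _ hv).
rewrite (_ : \sum_i _ = N^-1 * \sum_i \sum_j M i j * (\sum_w u i w * v j w)).
  by rewrite mulrC ler_pdivrMr// mulrC.
rewrite mulr_sumr; apply: eq_bigr => i _; rewrite mulr_sumr; apply: eq_bigr => j _.
rewrite -c2 mulrCA; congr (_ * _); rewrite mulr_sumr; apply: eq_bigr => w _; ring.
Qed.

Definition clip (R : realType) (x : R) : R :=
  if 2 < x then 2 else if x < - 2 then - 2 else x.

(** The last bound is 8 (y - 2) <= y^2, that is (y - 4)^2 >= 0, for y = |x|. It controls the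
    remainder by the fourth moment, which is at most 3, so that four times the remainder still has
    norm at most 1. *)
Lemma clipP (R : realType) (x : R) :
  [/\ `|clip x / 2| <= 1, clip x ^+ 2 <= x ^+ 2 &
      (4 * (x - clip x)) ^+ 2 <= x ^+ 4 / 4].
Proof.
rewrite /clip -[4%N]/(2 * 2)%N exprM.
have key (y : R) : 2 < y -> (4 * (y - 2)) ^+ 2 <= (y ^+ 2) ^+ 2 / 4.
  move=> y2; have := sqr_ge0 (y - 4) => y4.
  have h1 : 0 <= 8 * (y - 2) by lra.
  have h2 : 8 * (y - 2) <= y ^+ 2 by nra.
  have : (8 * (y - 2)) ^+ 2 <= (y ^+ 2) ^+ 2 by apply: lerXn2r; rewrite ?nnegrE ?sqr_ge0.
  lra.
case: ltP => x2; last case: ltP => x2'.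
- split; [by rewrite ler_norml; apply/andP; split; lra | nra | exact: key].
- split; [by rewrite ler_norml; apply/andP; split; lra | nra | ].
  by have := key (- x); rewrite sqrrN => /(_ ltac:(lra)); lra.
- split; [by rewrite ler_norml; apply/andP; split; lra | by [] |].
  by rewrite subrr mulr0 expr0n/=; have := sqr_ge0 (x ^+ 2); lra.
Qed.

(* Round with Rademacher sums clipped at 2: the clipped parts lie in a box,
   where the cut bound applies, and the remainders have norm at most 1/4, so
   that the bound C is only paid with a factor 1/4 for each of two cross terms. *)
Lemma hilbert_bound_step (R : realType) (I J : finType) (M : I -> J -> R) (B C : R) :
  (forall (S : {set I}) (U : {set J}), `|\sum_(i in S) \sum_(j in U) M i j| <= B) ->
  hilbert_bound M C -> hilbert_bound M (16 * B + C / 2).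
Proof.
move=> HB HC W u v hu hv.
have [W' [s [W0 s2 s4]]] := @rademacher R W (index_enum W) (index_enum_uniq W).
set N : R := #|W'|%:R.
have N0 : 0 < N by rewrite ltr0n.
pose g (K : finType) (z : K -> W -> R) i w' := \sum_w z i w * s w w'.
have g2 (K : finType) (z : K -> W -> R) : (forall i, \sum_w z i w ^+ 2 <= 1) ->
    forall i, \sum_w' g _ z i w' ^+ 2 <= N.
  move=> hz i; under eq_bigr => w _ do rewrite expr2.
  rewrite s2 -[leRHS]mulr1 ler_pM2l//.
  by under eq_bigr => w _ do rewrite -expr2.
have a2 (K : finType) (z : K -> W -> R) : (forall i, \sum_w z i w ^+ 2 <= 1) ->
    forall i, \sum_w' clip (g _ z i w') ^+ 2 <= N.
  move=> hz i; apply: le_trans (g2 _ _ hz i); apply: ler_sum => w' _.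
  by case: (clipP (g _ z i w')).
have h2 (K : finType) (z : K -> W -> R) : (forall i, \sum_w z i w ^+ 2 <= 1) ->
    forall i, \sum_w' (4 * (g _ z i w' - clip (g _ z i w'))) ^+ 2 <= N.
  move=> hz i; apply: (@le_trans _ _ (\sum_w' g _ z i w' ^+ 4 / 4)).
    by apply: ler_sum => w' _; case: (clipP (g _ z i w')).
  rewrite -mulr_suml ler_pdivrMr//; apply: le_trans (s4 _) _.
  rewrite -/N ler_pM2l//; set q := \sum_(_ <- _) _.
  have q0 : 0 <= q by apply: sumr_ge0 => w _; exact: sqr_ge0.
  have q1 : q <= 1 by exact: hz.
  nra.
have H := hilbert_bound_scale N0 HC.
have H1 := H _ _ _ (a2 _ _ hu) (h2 _ _ hv).
have H2 := H _ _ _ (h2 _ _ hu) (g2 _ _ hv).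
(* Halving both clipped factors to reach the unit box costs 4, and [cut_box] costs another 4. *)
have H3 : \sum_i \sum_j M i j * (\sum_w' clip (g _ u i w') * clip (g _ v j w'))
    <= N * (16 * B).
  rewrite (_ : \sum_i _ = \sum_w' \sum_i \sum_j
      4 * (M i j * ((clip (g _ u i w') / 2) * (clip (g _ v j w') / 2)))); last first.
    rewrite [RHS]exchange_big/=; apply: eq_bigr => i _.
    rewrite [RHS]exchange_big/=; apply: eq_bigr => j _.
    rewrite mulr_sumr; apply: eq_bigr => w' _; by field.
  have -> : N * (16 * B) = \sum_(w' in W') 16 * B.
    by rewrite sumr_const -[RHS]mulr_natl.
  apply: ler_sum => w' _.
  under eq_bigr => i _ do rewrite -mulr_sumr.
  rewrite -mulr_sumr.
  have c1 t : `|clip t / 2| <= 1 :> R by case: (clipP t).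
  have := cut_box HB (fun i => c1 (g _ u i w')) (fun j => c1 (g _ v j w')).
  lra.
have E : N * (\sum_i \sum_j M i j * (\sum_w u i w * v j w)) =
    \sum_i \sum_j M i j * (\sum_w' clip (g _ u i w') * clip (g _ v j w'))
  + (\sum_i \sum_j M i j *
      (\sum_w' clip (g _ u i w') * (4 * (g _ v j w' - clip (g _ v j w'))))) / 4
  + (\sum_i \sum_j M i j *
      (\sum_w' (4 * (g _ u i w' - clip (g _ u i w'))) * g _ v j w')) / 4.
  rewrite mulr_sumr !mulr_suml -!big_split/=; apply: eq_bigr => i _.
  rewrite mulr_sumr !mulr_suml -!big_split/=; apply: eq_bigr => j _.
  rewrite mulrCA -s2 -!mulrA -!mulrDr; congr (_ * _).
  rewrite !mulr_suml -!big_split/=; apply: eq_bigr => w' _.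
  rewrite -/(g _ u i w') -/(g _ v j w'); by field.
rewrite -(ler_pM2l N0) E; lra.
Qed.

(** The map sending C to 16 B + C / 2 is a contraction with fixed point 32 B. It is iterated from
    the trivial bound [C0], and the error [|C0 - 32 * B| / 2 ^+ m] tends to 0. *)
Lemma grothendieck (R : realType) (I J : finType) (M : I -> J -> R) (B : R) :
  (forall (S : {set I}) (U : {set J}), `|\sum_(i in S) \sum_(j in U) M i j| <= B) ->
  hilbert_bound M (32 * B).
Proof.
move=> HB.
pose C0 := \sum_i \sum_j `|M i j|.
have C00 : 0 <= C0 by apply: sumr_ge0 => i _; apply: sumr_ge0 => j _.
have HC0 : hilbert_bound M C0.
  move=> W u v hu hv; apply: ler_sum => i _; apply: ler_sum => j _.
  apply: le_trans (ler_norm _) _; rewrite normrM ler_piMr//.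
  apply: le_trans (ler_norm_sum _ _ _) _.
  apply: (@le_trans _ _ (\sum_w (u i w ^+ 2 + v j w ^+ 2) / 2)).
    apply: ler_sum => w _; rewrite normrM.
    have := sqr_ge0 (`|u i w| - `|v j w|); rewrite sqrrB !real_normK ?num_real//; lra.
  by rewrite -mulr_suml big_split/=; have := hu i; have := hv j; lra.
have Hm m : hilbert_bound M (32 * B + `|C0 - 32 * B| / 2 ^+ m).
  elim: m => [|m IH].
    rewrite expr0 divr1 => W u v hu hv; apply: le_trans (HC0 W u v hu hv) _.
    have := ler_norm (C0 - 32 * B); lra.
  move=> W u v hu hv; apply: le_trans (hilbert_bound_step HB IH hu hv) _.
  by rewrite exprS invfM; lra.
move=> W u v hu hv; apply/ler_addgt0Pr => e e0.
have [m hm] : exists m : nat, `|C0 - 32 * B| / 2 ^+ m <= e.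
  have [m /ltW hm] : exists m : nat, `|C0 - 32 * B| / e < m%:R.
    exists (Num.bound (`|C0 - 32 * B| / e)).
    by apply: archi_boundP; rewrite divr_ge0// ltW.
  exists m; rewrite ler_pdivrMr ?exprn_gt0// -ler_pdivrMl// [leLHS]mulrC.
  by apply: le_trans hm _; rewrite -natrX ler_nat ltnW// ltn_expl.
by apply: le_trans (Hm m W u v hu hv) _; rewrite lerD2l.
Qed.

(** * Adjacency and switchings in regular graphs *)

Definition adj (R : realType) n (E : graph n) (i j : 'I_n) : R := ((i, j) \in E)%:R.

Lemma adj_sym (R : realType) n (E : graph n) i j :
  simple_graph E -> adj R E i j = adj R E j i.
Proof. by case/andP=> _ /forallP/(_ i)/forallP/(_ j)/eqP; rewrite /adj => ->. Qed.

Lemma regularP (R : realType) n r (E : graph n) :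
  reflect (simple_graph E /\ forall i, \sum_j adj R E i j = r%:R) (regular r E).
Proof.
(* [regular] counts a classical set, whose membership is unfolded pointwise here. *)
have cardE i : #|[set j : 'I_n | (i, j) \in E]%classic|%:R = \sum_j adj R E i j.
  rewrite -sum1_card natr_sum big_mkcond/=; apply: eq_bigr => j _.
  rewrite /adj; have -> : (j \in [set j : 'I_n | (i, j) \in E]%classic) = ((i, j) \in E).
    by apply/idP/idP; rewrite inE.
  by case: ifP.
apply: (iffP andP) => -[sE /= h]; split => //.
  by move=> i; rewrite -cardE; move/forallP: h => /(_ i)/eqP ->.
by apply/forallP => i; rewrite -(eqr_nat R) cardE h.
Qed.

Definition switching n := ('I_n * 'I_n * 'I_n * 'I_n)%type.

(* The switching (a, b, c, d) replaces the edges ab, cd by ad, cb.  As a symmetric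
   difference it is an involution, undone by (a, d, c, b). *)
Definition switch n (E : graph n) (x : switching n) : graph n :=
  let: (a, b, c, d) := x in
  [set p | (p \in E) (+) (p \in [:: (a, b); (b, a); (c, d); (d, c);
                                    (a, d); (d, a); (c, b); (b, c)])].

Definition switchable n (E : graph n) (x : switching n) : bool :=
  let: (a, b, c, d) := x in
  [&& (a, b) \in E, (c, d) \in E, (a, d) \notin E, (c, b) \notin E, a != d & c != b].

Definition switch_rev n (x : switching n) : switching n :=
  let: (a, b, c, d) := x in (a, d, c, b).

Lemma switch_revK n (E : graph n) (x : switching n) :
  switch (switch E x) (switch_rev x) = E.
Proof.
case: x => [[[a b] c] d]; apply/setP => p; rewrite /= !inE -addbA.
rewrite [X in _ (+) X](_ : _ = false) ?addbF//.
by do 8![case: (p == _) => //=].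
Qed.

Section SwitchableGraph.
Variables (R : realType) (n : nat) (E : graph n) (a b c d : 'I_n).
Hypotheses (sE : simple_graph E) (vE : switchable E (a, b, c, d)).

Let memE : ((a, b) \in E) * ((b, a) \in E) * ((c, d) \in E) * ((d, c) \in E) *
  (((a, d) \in E) = false) * (((d, a) \in E) = false) *
  (((c, b) \in E) = false) * (((b, c) \in E) = false).
Proof.
have sym i j : ((i, j) \in E) = ((j, i) \in E).
  by case/andP: sE => _ /forallP/(_ i)/forallP/(_ j)/eqP.
case/and5P: vE => ab cd /negbTE ad /negbTE cb _.
by rewrite (sym b) (sym d c) (sym d) (sym b c) ab cd ad cb.
Qed.

(** The four vertices are distinct: a = c would put the same pair ab = cb both in and outside [E],
    and b = d likewise ab = ad. *)
Let neqs : ((a == b) = false) * ((b == a) = false) * ((c == d) = false) *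
  ((d == c) = false) * ((a == d) = false) * ((d == a) = false) *
  ((c == b) = false) * ((b == c) = false) *
  ((a == c) = false) * ((c == a) = false) * ((b == d) = false) * ((d == b) = false).
Proof.
have loop i : ((i, i) \in E) = false.
  by case/andP: sE => /forallP/(_ i)/negbTE.
have neq i j k : (i, j) \in E -> (i, k) \notin E -> (j == k) = false.
  by move=> ij ik; apply/eqP => jk; rewrite jk (negbTE ik) in ij.
have ab : (a == b) = false by rewrite eq_sym (neq a b a) ?memE// loop.
have cd : (c == d) = false by rewrite eq_sym (neq c d c) ?memE// loop.
have bd : (b == d) = false by rewrite (neq a) ?memE.
have ac : (a == c) = false by rewrite (neq b) ?memE.
case/and5P: vE => _ _ _ _ /andP[/negbTE ad /negbTE cb].
rewrite ![b == a]eq_sym ![d == c]eq_sym ![d == a]eq_sym ![b == c]eq_sym.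
by rewrite ![c == a]eq_sym ![d == b]eq_sym ab cd ad cb ac bd.
Qed.

Let ends (x y i j : 'I_n) : R :=
  (i == x)%:R * (j == y)%:R + (i == y)%:R * (j == x)%:R.

Lemma adj_switch i j :
  adj R (switch E (a, b, c, d)) i j =
  adj R E i j + ends a d i j + ends c b i j - ends a b i j - ends c d i j.
Proof.
rewrite /adj /ends !inE !xpair_eqE.
case: (eqVneq i a) => [->|ia]; [|case: (eqVneq i b) => [->|ib];
 [|case: (eqVneq i c) => [->|ic]; [|case: (eqVneq i d) => [->|id]]]];
 rewrite ?eqxx ?neqs /=; last by rewrite addbF; ring.
all: case: (eqVneq j a) => [->|ja]; [|case: (eqVneq j b) => [->|jb];
 [|case: (eqVneq j c) => [->|jc]; [|case: (eqVneq j d) => [->|jd]]]];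
 rewrite ?eqxx ?neqs ?memE ?addbF /=; ring.
Qed.

Lemma switchable_rev : switchable (switch E (a, b, c, d)) (a, d, c, b).
Proof. by rewrite /= !inE !xpair_eqE !eqxx !neqs !memE. Qed.

Lemma simple_switch : simple_graph (switch E (a, b, c, d)).
Proof.
case/andP: sE => /forallP loop /forallP sym.
apply/andP; split; apply/forallP => i.
  rewrite !inE !xpair_eqE (negbTE (loop i)) /=.
  case: (eqVneq i a) => [->|ia]; first by rewrite !neqs.
  case: (eqVneq i b) => [->|ib]; first by rewrite !neqs.
  case: (eqVneq i c) => [->|ic]; first by rewrite !neqs.
  by rewrite !andbF.
apply/forallP => j; rewrite !inE (eqP (forallP (sym i) j)) !xpair_eqE.
apply/eqP; congr (_ (+) _).
by do 8![case: (_ == _) => //=].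
Qed.

(** A general test function [F] serves twice: the indicator of a row shows that degrees are
    preserved, and [p i * q j] gives the change of an edge count. *)
Lemma sum_adj_switch (F : 'I_n -> 'I_n -> R) :
  \sum_i \sum_j adj R (switch E (a, b, c, d)) i j * F i j =
  \sum_i \sum_j adj R E i j * F i j +
  ((F a d + F d a) + (F c b + F b c) - (F a b + F b a) - (F c d + F d c)).
Proof.
have dsum x y : \sum_i \sum_j (i == x)%:R * (j == y)%:R * F i j = F x y.
  rewrite (bigD1 x)//= [X in _ + X]big1 ?addr0 => [|i /negbTE ->]; last first.
    by rewrite big1// => j _; rewrite !mul0r.
  rewrite (bigD1 y)//= [X in _ + X]big1 ?addr0 => [|j /negbTE ->].
    by rewrite !eqxx !mul1r.
  by rewrite mulr0 mul0r.
have esum x y : \sum_i \sum_j ends x y i j * F i j = F x y + F y x.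
  rewrite -!dsum -big_split/=; apply: eq_bigr => i _.
  by rewrite -big_split/=; apply: eq_bigr => j _; rewrite mulrDl.
rewrite -!esum -big_split/= -!sumrB -big_split/=; apply: eq_bigr => i _.
rewrite -big_split/= -!sumrB -big_split/=; apply: eq_bigr => j _.
by rewrite adj_switch; ring.
Qed.

Lemma regular_switch r : regular r E -> regular r (switch E (a, b, c, d)).
Proof.
case/(regularP R) => _ rE; apply/(regularP R); split; first exact: simple_switch.
move=> i; pose F (k j : 'I_n) : R := (k == i)%:R.
have rowE (E' : graph n) : \sum_k \sum_j adj R E' k j * F k j = \sum_j adj R E' i j.
  rewrite (bigD1 i)//= [X in _ + X]big1 ?addr0 => [|k /negbTE ki]; last first.
    by rewrite big1// => j _; rewrite /F ki mulr0.
  by apply: eq_bigr => j _; rewrite /F eqxx mulr1.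
by rewrite -rowE sum_adj_switch rowE rE /F; ring.
Qed.

End SwitchableGraph.

(** The involution taking [(E, x)] to [(switch E x, switch_rev x)] preserves regularity and
    switchability, and reindexing by it exchanges the two sides. *)
Lemma switch_balance (R : realType) n r (w : graph n -> R) :
  \sum_(E : graph n | regular r E) \sum_(x | switchable E x) w (switch E x) =
  \sum_(E : graph n | regular r E) \sum_(x | switchable E x) w E.
Proof.
rewrite !pair_big_dep/=.
pose s (p : graph n * switching n) := (switch p.1 p.2, switch_rev p.2).
have sK : involutive s.
  by case=> E x; rewrite /s/= switch_revK; case: x => [[[]]].
rewrite [RHS](reindex_inj (inv_inj sK))/=; apply: eq_bigl => -[E x].
have imp (p : graph n * switching n) : regular r p.1 && switchable p.1 p.2 ->
    regular r (s p).1 && switchable (s p).1 (s p).2.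
  case: p => E' [[[a b] c] d] /andP[rE vE].
  have /andP[sE _] := rE.
  apply/andP; split; last exact: (switchable_rev sE vE).
  exact: (regular_switch R sE vE rE).
apply/idP/idP => h; first exact: (imp (E, x) h).
by have := imp (s (E, x)) h; rewrite sK.
Qed.

(** * Drift of the edge count under a random switching *)

(** Here exp x <= 1 / (1 - x), and (1 - x)(1 + x + 2 x^2) = 1 + x^2 (1 - 2 x) is at least 1. *)
Lemma expR_le_quadratic (R : realType) (x : R) : x <= 2^-1 -> expR x <= 1 + x + 2 * x ^+ 2.
Proof.
move=> x2; have x1 : 0 < 1 - x by lra.
have : (expR x)^-1 >= 1 - x by rewrite -expRN; have := expR_ge1Dx (- x); lra.
rewrite -[1 - x]invrK lef_pV2 ?posrE ?invr_gt0 ?expR_gt0// => h.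
apply: le_trans h _; rewrite -div1r ler_pdivrMr//.
have := sqr_ge0 x; nra.
Qed.

Section SwitchingDrift.
Variables (R : realType) (n r : nat) (E : graph n).
Hypothesis rE : regular r E.
Local Notation A := (adj R E).

Let rows i : \sum_j A i j = r%:R.
Proof. by case/(regularP R): rE. Qed.

Let symA i j : A i j = A j i.
Proof. by apply: adj_sym; case/andP: rE. Qed.

Let cols j : \sum_i A i j = r%:R.
Proof. by rewrite -(rows j); apply: eq_bigr => i _; rewrite symA. Qed.

Let total : \sum_i \sum_j A i j = r%:R * n%:R.
Proof.
by under eq_bigr => i _ do rewrite rows; rewrite sumr_const card_ord mulr_natr.
Qed.

Let pairwt (x : switching n) := A x.1.1.1 x.1.1.2 * A x.1.2 x.2.

Let sum_switching (G : 'I_n -> 'I_n -> 'I_n -> 'I_n -> R) :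
  \sum_(x : switching n) G x.1.1.1 x.1.1.2 x.1.2 x.2 =
  \sum_a \sum_b \sum_c \sum_d G a b c d.
Proof. by rewrite !pair_bigA. Qed.

(** The ends a and d lie on different darts, so b and c sum out to a factor r each; in [sum_ab] the
    whole dart cd sums out instead, to r n. *)
Let sum_ad (F : 'I_n -> 'I_n -> R) :
  \sum_x pairwt x * F x.1.1.1 x.2 = r%:R ^+ 2 * \sum_i \sum_j F i j.
Proof.
rewrite (sum_switching (fun a b c d => A a b * A c d * F a d)) mulr_sumr.
apply: eq_bigr => a _.
transitivity (\sum_b A a b * \sum_c \sum_d A c d * F a d).
  apply: eq_bigr => b _; rewrite mulr_sumr; apply: eq_bigr => c _.
  by rewrite mulr_sumr; apply: eq_bigr => d _; rewrite mulrA.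
rewrite -mulr_suml rows expr2 -mulrA; congr (_ * _).
by rewrite exchange_big mulr_sumr; apply: eq_bigr => d _; rewrite -mulr_suml cols.
Qed.

Let sum_ab (F : 'I_n -> 'I_n -> R) :
  \sum_x pairwt x * F x.1.1.1 x.1.1.2 = r%:R * n%:R * \sum_i \sum_j A i j * F i j.
Proof.
rewrite (sum_switching (fun a b c d => A a b * A c d * F a b)) mulr_sumr.
apply: eq_bigr => a _; rewrite mulr_sumr; apply: eq_bigr => b _.
rewrite -total mulr_suml; apply: eq_bigr => c _; rewrite mulr_suml.
by apply: eq_bigr => d _; ring.
Qed.

Let sum_swap (G : 'I_n -> 'I_n -> 'I_n -> 'I_n -> R) :
  \sum_(x : switching n) G x.1.1.1 x.1.1.2 x.1.2 x.2 =
  \sum_(x : switching n) G x.1.2 x.2 x.1.1.1 x.1.1.2.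
Proof.
pose s (x : switching n) : switching n := (x.1.2, x.2, x.1.1.1, x.1.1.2).
have sK : involutive s by case=> [[[]]].
by rewrite [RHS](reindex_inj (inv_inj sK)).
Qed.

Let sum_cb (F : 'I_n -> 'I_n -> R) :
  \sum_x pairwt x * F x.1.2 x.1.1.2 = r%:R ^+ 2 * \sum_i \sum_j F i j.
Proof.
rewrite (sum_swap (fun a b c d => A a b * A c d * F c b)) -sum_ad.
by apply: eq_bigr => x _; congr (_ * _); rewrite mulrC.
Qed.

Let sum_cd (F : 'I_n -> 'I_n -> R) :
  \sum_x pairwt x * F x.1.2 x.2 = r%:R * n%:R * \sum_i \sum_j A i j * F i j.
Proof.
rewrite (sum_swap (fun a b c d => A a b * A c d * F c d)) -sum_ab.
by apply: eq_bigr => x _; congr (_ * _); rewrite mulrC.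
Qed.

Variables (p q : 'I_n -> R) (theta : R).
Hypotheses (p01 : forall i, 0 <= p i <= 1) (q01 : forall i, 0 <= q i <= 1).
Hypotheses (theta0 : 0 <= theta) (theta1 : theta <= 4^-1) (r0 : (0 < r)%N).

Let t i j := p i * q j + p j * q i.

Let gain (x : switching n) :=
  t x.1.1.1 x.2 + t x.1.2 x.1.1.2 - t x.1.1.1 x.1.1.2 - t x.1.2 x.2.

(** The gain factors as (p a - p c)(q d - q b) + (p d - p b)(q a - q c). *)
Let gain_le x : - 2 <= gain x <= 2.
Proof.
case: x => [[[a b] c] d]; rewrite /gain /t/=.
have box (u v : R) : -1 <= u <= 1 -> -1 <= v <= 1 -> -1 <= u * v <= 1.
  by move=> h1 h2; apply/andP; split; nra.
have diff (f : 'I_n -> R) : (forall i, 0 <= f i <= 1) -> forall i j, -1 <= f i - f j <= 1.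
  by move=> f01 i j; have := f01 i; have := f01 j; lra.
have := box _ _ (diff _ p01 a c) (diff _ q01 d b).
have := box _ _ (diff _ p01 d b) (diff _ q01 a c).
by move=> /andP[? ?] /andP[? ?]; apply/andP; split; lra.
Qed.

(* Pairs of darts that cannot be switched are charged to an edge ad or cb, or to
   a coincidence a = d or c = b. *)
Let pointwise (x : switching n) :
  (switchable E x)%:R * (expR (- theta * gain x) - 1) <=
  - theta * (pairwt x * gain x) + 8 * theta ^+ 2 * pairwt x
  + 2 * theta * (pairwt x * A x.1.1.1 x.2 + pairwt x * A x.1.2 x.1.1.2 +
      pairwt x * (x.1.1.1 == x.2)%:R + pairwt x * (x.1.2 == x.1.1.2)%:R).
Proof.
have /andP[g1 g2] := gain_le x; move: (gain x) g1 g2 => g g1 g2.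
case: x => [[[a b] c] d]; rewrite /pairwt/= /adj.
case: ((a, b) \in E) => /=; last by rewrite !mul0r; lra.
case: ((c, d) \in E) => /=; last by rewrite !mulr0 !mul0r; lra.
have th0 := theta0; have th1 := theta1.
have tg : theta * g <= 2 * theta by rewrite mulrC ler_wpM2r.
have t2 : 0 <= theta ^+ 2 by exact: sqr_ge0.
(* A gain in [-2, 2] and [theta <= 4^-1] keep the exponent at most 1/2; the quadratic term is at
   most 2 (2 theta)^2. *)
have e1 : expR (- theta * g) <= 1 + - theta * g + 8 * theta ^+ 2.
  apply: le_trans (@expR_le_quadratic _ _ _) _; first by have := ler_wpM2l theta0 g1; rewrite mulNr; have := theta1; lra.
  rewrite exprMn sqrrN.
  have : theta ^+ 2 * g ^+ 2 <= theta ^+ 2 * 4 by rewrite ler_wpM2l//; nra.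
  lra.
(* If the switching is blocked, one of the four indicators is 1 and its 2 theta pays for
   [theta * g]. *)
case: ((a, d) \in E); case: ((c, b) \in E); case: (a == d); case: (c == b) => /=; lra.
Qed.

Lemma switching_drift :
  \sum_(x | switchable E x) (expR (- theta * gain x) - 1) <=
  - theta * (4 * r%:R ^+ 2 * ((\sum_i p i) * (\sum_i q i))
     - 4 * (r%:R * n%:R) * (\sum_i \sum_j A i j * (p i * q j)) - 8 * n%:R * r%:R ^+ 3)
  + 8 * theta ^+ 2 * (r%:R * n%:R) ^+ 2.
Proof.
have -> : \sum_(x | switchable E x) (expR (- theta * gain x) - 1) =
    \sum_x (switchable E x)%:R * (expR (- theta * gain x) - 1).
  rewrite big_mkcond; apply: eq_bigr => x _; case: ifP; by rewrite (mul1r, mul0r).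
apply: le_trans (ler_sum _ (fun x _ => pointwise x)) _.
set f := \sum_i \sum_j A i j * (p i * q j).
have tsum : \sum_i \sum_j t i j = 2 * ((\sum_i p i) * (\sum_i q i)).
  rewrite mulr_natl mulr2n {2}[_ * \sum_i q i]mulrC !big_distrl/= -big_split/=.
  apply: eq_bigr => i _; rewrite !mulr_sumr -big_split/=; apply: eq_bigr => j _.
  by rewrite /t; ring.
have Atsum : \sum_i \sum_j A i j * t i j = 2 * f.
  have flip : \sum_i \sum_j A i j * (p j * q i) = f.
    rewrite exchange_big; apply: eq_bigr => i _; apply: eq_bigr => j _.
    by rewrite symA.
  rewrite mulr_natl mulr2n -{2}flip -big_split/=; apply: eq_bigr => i _.
  by rewrite -big_split/=; apply: eq_bigr => j _; rewrite -mulrDr.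
have wsum : \sum_x pairwt x = (r%:R * n%:R) ^+ 2.
  have := sum_ab (fun _ _ => 1); under eq_bigr => x _ do rewrite mulr1.
  move=> ->; rewrite expr2; congr (_ * _); rewrite -total.
  by apply: eq_bigr => i _; apply: eq_bigr => j _; rewrite mulr1.
have gsum : \sum_x pairwt x * gain x =
    4 * r%:R ^+ 2 * ((\sum_i p i) * (\sum_i q i)) - 4 * (r%:R * n%:R) * f.
  under eq_bigr => x _ do rewrite !mulrBr mulrDr.
  by rewrite !sumrB big_split/= sum_ad sum_cb sum_ab sum_cd tsum Atsum; ring.
have dsum : \sum_(i < n) \sum_(j < n) (i == j)%:R = n%:R :> R.
  rewrite (eq_bigr (fun=> 1)) => [|i _]; last first.
    rewrite (bigD1 i)//= eqxx big1 ?addr0// => j.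
    by rewrite eq_sym => /negbTE ->.
  by rewrite sumr_const card_ord.
rewrite !big_split/= -!mulr_sumr !big_split/= gsum wsum.
rewrite sum_ad sum_cb total (sum_ad (fun i j => (i == j)%:R)).
rewrite (sum_cb (fun i j => (i == j)%:R)) dsum.
(* Blocking edges contribute 2 r^3 n and coincidences 2 r^2 n; r >= 1 merges both into 4 r^3 n. *)
have r1 : 1 <= r%:R :> R by rewrite ler1n.
have : 0 <= theta * n%:R * r%:R ^+ 2 * (r%:R - 1).
  by rewrite !mulr_ge0// ?sqr_ge0// subr_ge0.
lra.
Qed.

End SwitchingDrift.

(** * Tail bound for the discrepancy of a fixed pair *)

(** Each element contributes at least -1 to the sum, and at least L exp L once y reaches L, so a sum
    that is not positive limits how many elements do. *)
Lemma card_exp_tail (R : realType) (T : finType) (P : pred T) (y : T -> R) (L : R) :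
  0 <= L -> \sum_(x | P x) expR (y x) * y x <= 0 ->
  #|[set x | P x & L <= y x]|%:R * (L * expR L) <= #|[set x | P x]|%:R.
Proof.
move=> L0 ysum.
have key x : (L <= y x)%R%:R * (L * expR L) - 1 <= expR (y x) * y x.
  have e0 := expR_gt0 (y x).
  have lo : -1 <= expR (y x) * y x.
    have := expR_ge1Dx (- y x); rewrite expRN => h.
    have : expR (y x) * (1 - y x) <= 1 by rewrite mulrC -ler_pdivlMr// div1r.
    lra.
  case: (lerP L (y x)) => Ly /=; last by rewrite mul0r sub0r.
  rewrite mul1r; have : L * expR L <= expR (y x) * y x.
    by rewrite mulrC ler_pM// ?expR_ge0// ler_expR.
  lra.
have : \sum_(x | P x) ((L <= y x)%R%:R * (L * expR L) - 1) <= 0.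
  by apply: le_trans ysum; apply: ler_sum => x _; exact: key.
rewrite sumrB -mulr_suml subr_le0.
have -> : \sum_(x | P x) (L <= y x)%R%:R = #|[set x | P x & L <= y x]|%:R :> R.
  rewrite -sum1_card natr_sum [RHS]big_mkcond [LHS]big_mkcond/=.
  by apply: eq_bigr => x _; rewrite inE; case: (P x) => //=; case: (L <= y x).
suff <- : \sum_(x | P x) 1 = #|[set x | P x]|%:R :> R by [].
by rewrite -sum1_card natr_sum; apply: eq_bigl => x; rewrite inE.
Qed.

Lemma discrepancy_tail (R : realType) n r (p q : 'I_n -> R) (delta L : R) :
  (0 < n)%N -> (0 < r)%N -> 0 < delta -> delta <= 1 -> 8 * r%:R <= delta * n%:R ->
  (forall i, 0 <= p i <= 1) -> (forall i, 0 <= q i <= 1) ->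
  L = delta ^+ 2 * r%:R * n%:R / 16 ->
  #|[set E : graph n | regular r E &
      delta * r%:R * n%:R <= r%:R / n%:R * ((\sum_i p i) * (\sum_i q i))
        - \sum_i \sum_j adj R E i j * (p i * q j)]|%:R * (L * expR L)
  <= #|[set E : graph n | regular r E]|%:R.
Proof.
move=> n0 r0 d0 d1 rn p01 q01 LE.
have n0' : 0 < n%:R :> R by rewrite ltr0n.
have r0' : 0 < r%:R :> R by rewrite ltr0n.
(* With this choice both terms of [eta] below are at most delta r n / 4. A deficit of delta r n then
   leaves delta r n / 2, and multiplying by [theta] yields exactly L. *)
pose theta := delta / 8.
have th0 : 0 < theta by rewrite /theta; lra.
have th1 : theta <= 4^-1 by rewrite /theta; lra.
pose mu := r%:R / n%:R * ((\sum_i p i) * (\sum_i q i)).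
pose f (E : graph n) := \sum_i \sum_j adj R E i j * (p i * q j).
(* The two error terms of [switching_drift], divided by 4 r n theta; the drift bound becomes exactly
   -4 r n y. *)
pose eta : R := 2 * r%:R ^+ 2 + 2 * theta * (r%:R * n%:R).
pose y E := theta * (mu - f E - eta).
pose gain (x : switching n) :=
  (p x.1.1.1 * q x.2 + p x.2 * q x.1.1.1) +
  (p x.1.2 * q x.1.1.2 + p x.1.1.2 * q x.1.2) -
  (p x.1.1.1 * q x.1.1.2 + p x.1.1.2 * q x.1.1.1) -
  (p x.1.2 * q x.2 + p x.2 * q x.1.2).
have fswitch E x : regular r E -> switchable E x -> f (switch E x) = f E + gain x.
  case: x => [[[a b] c] d] /andP[sE _] vE.
  by rewrite /f (sum_adj_switch sE vE (fun i j => p i * q j)) /gain/=; ring.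
have ysum : \sum_(E : graph n | regular r E) expR (y E) * y E <= 0.
  have /eqP := switch_balance r (fun E => expR (y E)); rewrite -subr_eq0 -sumrB => /eqP bal.
  have : 0 <= \sum_(E : graph n | regular r E)
       expR (y E) * (- (4 * (r%:R * n%:R)) * y E).
    rewrite -[leLHS]bal; apply: ler_sum => E rE; rewrite -sumrB.
    rewrite (eq_bigr (fun x => expR (y E) * (expR (- theta * gain x) - 1))); last first.
      move=> x vE; rewrite mulrBr mulr1 -expRD; congr (expR _ - _).
      by rewrite /y (fswitch _ _ rE vE); ring.
    rewrite -mulr_sumr ler_wpM2l ?expR_ge0//.
    apply: le_trans (switching_drift rE p01 q01 (ltW th0) th1 r0) _.
    rewrite -/(f E) /y /mu /eta le_eqVlt; apply/orP; left; apply/eqP.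
    by field; rewrite ?gt_eqF.
  under eq_bigr => E _ do rewrite mulrCA.
  have c0 : - (4 * (r%:R * n%:R)) < 0 :> R by rewrite oppr_lt0 !mulr_gt0.
  by rewrite -mulr_sumr (nmulr_rge0 _ c0).
have L0 : 0 <= L by rewrite LE divr_ge0// mulr_ge0// mulr_ge0// sqr_ge0.
have := card_exp_tail L0 ysum.
apply: le_trans; apply: ler_wpM2r; first by rewrite mulr_ge0 ?expR_ge0.
rewrite ler_nat; apply: subset_leq_card; apply/fintype.subsetP => E; rewrite !inE => /andP[-> /=]; rewrite -/mu -/(f E) => h.
rewrite /y.
have h8 : 8 * r%:R * r%:R <= delta * n%:R * r%:R by rewrite ler_wpM2r.
have : delta * r%:R * n%:R / 2 <= mu - f E - eta by rewrite /eta /theta; lra.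
by move/(ler_wpM2l (ltW th0)); rewrite LE /theta; lra.
Qed.

(** * Vector chromatic number, discrepancy, and the union bound *)

(** Centred, rescaled basis vectors. They show that the infimum in [vec_chrom] is over a nonempty
    set, hence not a default value. *)
Lemma simplex_vectors (R : realType) n : (1 < n)%N ->
  exists v : 'I_n -> 'rV[R]_n,
    (forall i, dotv (v i) (v i) = 1) /\
    (forall i j, i != j -> dotv (v i) (v j) = - (n%:R - 1)^-1).
Proof.
move=> n1; have n1' : 1 < n%:R :> R by rewrite ltr1n.
have n0 : n%:R != 0 :> R by rewrite gt_eqF//; lra.
have m0 : n%:R - 1 != 0 :> R by rewrite gt_eqF//; lra.
pose c : R := Num.sqrt (n%:R / (n%:R - 1)).
have c2 : c ^+ 2 = n%:R / (n%:R - 1) by rewrite sqr_sqrtr// divr_ge0//; lra.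
pose v (i : 'I_n) : 'rV[R]_n := \row_l (c * ((i == l)%:R - n%:R^-1)).
exists v.
have dotE i j : dotv (v i) (v j) = c ^+ 2 * ((i == j)%:R - n%:R^-1).
  rewrite /dotv.
  transitivity (\sum_(l < n) c ^+ 2 * ((i == l)%:R * (j == l)%:R - n%:R^-1 * (i == l)%:R
      - n%:R^-1 * (j == l)%:R + n%:R^-1 ^+ 2)).
    by apply: eq_bigr => l _; rewrite !mxE; ring.
  rewrite -mulr_sumr; congr (_ * _); rewrite big_split/= !sumrB -!mulr_sumr.
  have s1 (k : 'I_n) : \sum_(l < n) (k == l)%:R = 1 :> R.
    by rewrite (bigD1 k)//= eqxx big1 ?addr0// => l; rewrite eq_sym => /negbTE ->.
  have s2 : \sum_(l < n) (i == l)%:R * (j == l)%:R = (i == j)%:R :> R.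
    rewrite (bigD1 i)//= eqxx mul1r big1 ?addr0 1?eq_sym// => l.
    by rewrite eq_sym => /negbTE ->; rewrite mul0r.
  by rewrite s2 !s1 sumr_const card_ord -mulr_natr; field.
split=> [i|i j /negbTE ij]; rewrite dotE c2 ?eqxx ?ij /=; field; exact/andP.
Qed.

(** A slack of 1 replaces attainment of the infimum: k' < x + 1 still gives inner products at most
    -1/x on edges when x > 0. *)
Lemma vec_chrom_le (R : realType) n (E : graph n) (x : R) :
  (1 < n)%N -> simple_graph E -> vec_chrom R E <= x ->
  exists (k' : R) (v : 'I_n -> 'rV[R]_n), [/\ 1 < k', k' < x + 1,
    forall i, dotv (v i) (v i) = 1 &
    forall i j, (i, j) \in E -> dotv (v i) (v j) <= - (k' - 1)^-1].
Proof.
move=> n1 /andP[/forallP loop _]; rewrite /vec_chrom; set X := mkset _ => infX.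
have Xinf : has_inf X.
  split; last by exists 1 => k' [/ltW].
  exists n%:R; split; first by rewrite ltr1n.
  have [v [v1 vij]] := simplex_vectors R n1; exists v; split => // i j ij.
  by rewrite vij//; apply/eqP => eij; have := loop i; rewrite {2}eij ij.
have [k' [k1 [v [v1 vE]]] k'lt] := inf_adherent ltr01 Xinf.
by exists k', v; split => //; apply: lt_le_trans k'lt _; rewrite lerD2r.
Qed.

Definition indic (R : realType) n (S : {set 'I_n}) (i : 'I_n) : R := (i \in S)%:R.

(** One-sided: positive when S and U span fewer ordered pairs than density r/n predicts. *)
Definition discrepancy (R : realType) n (r : nat) (E : graph n) (S U : {set 'I_n}) : R :=
  r%:R / n%:R * ((\sum_i indic R S i) * (\sum_i indic R U i))
  - \sum_i \sum_j adj R E i j * (indic R S i * indic R U j).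

Lemma vector_colouring_discrepancy (R : realType) n r (E : graph n) (k : R)
    (v : 'I_n -> 'rV[R]_n) :
  (0 < n)%N -> (0 < r)%N -> 0 < k -> regular r E ->
  (forall i, dotv (v i) (v i) = 1) ->
  (forall i j, (i, j) \in E -> dotv (v i) (v j) <= - k^-1) ->
  exists S U, (64 * k)^-1 * r%:R * n%:R <= discrepancy R r E S U.
Proof.
move=> n0 r0 k0 /[dup] /andP[sE _] /(regularP R)[_ rows] v1 vE.
have n0' : 0 < n%:R :> R by rewrite ltr0n.
have r0' : 0 < r%:R :> R by rewrite ltr0n.
set B := _ * n%:R.
case: (boolP [exists S, exists U, B <= discrepancy R r E S U]).
  by move=> /existsP[S /existsP[U h]]; exists S, U.
move=> /existsPn noS; exfalso.
have small S U : discrepancy R r E S U <= B.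
  by move: (noS S) => /existsPn/(_ U); rewrite -ltNge => /ltW.
pose M i j := r%:R / n%:R - adj R E i j.
have discE (S U : {set 'I_n}) : \sum_(i in S) \sum_(j in U) M i j = discrepancy R r E S U.
  rewrite /discrepancy big_distrl/= mulr_sumr -sumrB [LHS]big_mkcond/=.
  apply: eq_bigr => i _; rewrite {1 3}/indic; case: (i \in S) => /=; last first.
    by rewrite mul0r mulr0 big1 ?subr0// => j _; rewrite mul0r mulr0.
  rewrite mul1r mulr_sumr -sumrB [LHS]big_mkcond/=; apply: eq_bigr => j _.
  by rewrite /indic mul1r; case: (j \in U); rewrite ?mulr1 ?mulr0 ?subr0.
have colM j : \sum_i M i j = 0.
  have col : \sum_i adj R E i j = r%:R.
    by rewrite -(rows j); apply: eq_bigr => i _; exact: adj_sym.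
  rewrite sumrB col sumr_const card_ord -[X in X - _]mulr_natr divfK ?subrr//.
  by rewrite gt_eqF.
(* As the columns of [M] sum to 0, complementing S changes the sign, which makes the one-sided bound
   two-sided. *)
have compl (S U : {set 'I_n}) :
    \sum_(i in ~: S) \sum_(j in U) M i j = - \sum_(i in S) \sum_(j in U) M i j.
  apply/eqP; rewrite -addr_eq0 addrC; apply/eqP.
  transitivity (\sum_i \sum_(j in U) M i j).
    rewrite [RHS](bigID (mem S))/=; congr (_ + _).
    by apply: eq_bigl => i; rewrite inE.
  by rewrite exchange_big big1.
have cut (S U : {set 'I_n}) : `|\sum_(i in S) \sum_(j in U) M i j| <= B.
  rewrite ler_norml; apply/andP; split; last by rewrite discE.
  by rewrite lerNl -compl discE.
have vnorm i : \sum_l v i 0 l ^+ 2 <= 1.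
  by rewrite -(v1 i) /dotv; under eq_bigr => l _ do rewrite expr2.
have := grothendieck cut vnorm vnorm.
rewrite (_ : \sum_i _ = r%:R / n%:R * (\sum_l (\sum_i v i 0 l) ^+ 2)
    - \sum_i \sum_j adj R E i j * dotv (v i) (v j)); last first.
  transitivity (\sum_i \sum_j (r%:R / n%:R * dotv (v i) (v j)
      - adj R E i j * dotv (v i) (v j))).
    by apply: eq_bigr => i _; apply: eq_bigr => j _; rewrite mulrBl.
  under eq_bigr => i _ do rewrite sumrB -mulr_sumr.
  rewrite sumrB -mulr_sumr; congr (_ * _ - _).
  transitivity (\sum_i \sum_l \sum_j v i 0 l * v j 0 l).
    by apply: eq_bigr => i _; rewrite exchange_big.
  rewrite exchange_big; apply: eq_bigr => l _.
  by rewrite expr2 big_distrl/=; apply: eq_bigr => i _; rewrite mulr_sumr.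
(* The constant part of [M] contributes r/n times the squared norm of the sum of all vectors. *)
have sq : 0 <= r%:R / n%:R * (\sum_l (\sum_i v i 0 l) ^+ 2).
  by rewrite mulr_ge0 ?divr_ge0// sumr_ge0// => l _; exact: sqr_ge0.
have edges : \sum_i \sum_j adj R E i j * dotv (v i) (v j) <= - (r%:R * n%:R / k).
  rewrite (_ : - (_ / k) = \sum_i \sum_j adj R E i j * (- k^-1)); last first.
    under eq_bigr => i _ do rewrite -mulr_suml rows.
    by rewrite sumr_const card_ord -mulr_natr; field; rewrite gt_eqF.
  apply: ler_sum => i _; apply: ler_sum => j _; rewrite /adj.
  by case: (boolP ((i, j) \in E)) => [/vE ij|_]; rewrite ?mul0r ?mul1r.
(* With 64 in [B], Grothendieck allows only r n / (2k), while the edges force r n / k. *)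
have : 32 * B < r%:R * n%:R / k.
  rewrite /B invfM; have : 0 < r%:R * n%:R / k by rewrite !mulr_gt0 ?invr_gt0.
  lra.
lra.
Qed.

(* As 448 ^ 2 = 49 * 64 ^ 2, the exponent in the tail bound is at least 3n, against
   at most exp (2n) pairs (S, U). *)
Lemma card_small_vec_chrom (R : realType) n r k :
  (1 < n)%N -> (448 * k%:R) ^+ 2 <= r%:R :> R ->
  ((0 < k)%N -> 8 * r%:R <= (64 * k%:R)^-1 * n%:R :> R) ->
  #|[set E : graph n | regular r E & vec_chrom R E <= k%:R]|%:R * expR n%:R
  <= #|[set E : graph n | regular r E]|%:R :> R.
Proof.
move=> n1 kr rn; have n0 : (0 < n)%N by exact: ltnW.
have n1' : 1 <= n%:R :> R by rewrite ler1n.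
(* For k = 0 a witness would satisfy 1 < k' < 1. *)
case: (posnP k) => [k0|k0].
  suff -> : [set E : graph n | regular r E & vec_chrom R E <= k%:R] = finset.set0.
    by rewrite cards0 mul0r.
  rewrite k0; apply/setP => E; rewrite !inE; apply/negbTE/negP => /andP[rE].
  have /andP[sE _] := rE.
  by move=> /(vec_chrom_le n1 sE)[k' [v [k1 k2 _ _]]]; lra.
have k1 : 1 <= k%:R :> R by rewrite ler1n.
have r0 : (0 < r)%N.
  by rewrite -(ltr0n R); apply: lt_le_trans kr; rewrite exprn_gt0// mulr_gt0// ltr0n.
move/(_ k0): rn; set delta := (64 * k%:R)^-1 => rn.
have d0 : 0 < delta by rewrite invr_gt0; lra.
have d1 : delta <= 1 by rewrite invf_le1; lra.
pose L := delta ^+ 2 * r%:R * n%:R / 16.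
have L3 : 3 * n%:R <= L.
  have : 48 <= delta ^+ 2 * r%:R.
    rewrite /delta exprVn -ler_pdivrMl ?invr_gt0 ?exprn_gt0//; last by lra.
    by rewrite invrK; have := sqr_ge0 (k%:R : R); lra.
  by move/(ler_wpM2r (ler0n R n)); rewrite /L; lra.
pose bad S U := [set E : graph n | regular r E &
  delta * r%:R * n%:R <= discrepancy R r E S U].
have ind01 (S : {set 'I_n}) i : 0 <= indic R S i <= 1.
  by rewrite /indic; case: (i \in S); rewrite ?lexx ler01.
have badle S U : #|bad S U|%:R * (L * expR L) <= #|[set E : graph n | regular r E]|%:R.
  exact: (discrepancy_tail n0 r0 d0 d1 rn (ind01 S) (ind01 U) (erefl L)).
have cover : (#|[set E : graph n | (regular r E) && (vec_chrom R E <= k%:R)%R]|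
    <= \sum_S \sum_U #|bad S U|)%N.
  rewrite pair_bigA/=.
  apply: (@leq_trans #|\bigcup_p bad p.1 p.2|); last first.
    elim/big_ind2: _ => [|A a B b Aa Bb|//]; first by rewrite cards0.
    by apply: leq_trans (leq_card_setU _ _) _; rewrite leq_add.
  apply: subset_leq_card; apply/fintype.subsetP => E; rewrite inE => /andP[rE].
  have /andP[sE _] := rE.
  move=> /(vec_chrom_le n1 sE)[k' [v [k'1 k'2 v1 vE]]].
  have vE' i j : (i, j) \in E -> dotv (v i) (v j) <= - k%:R^-1.
    move=> /vE h; apply: le_trans h _; rewrite lerN2 lef_pV2 ?posrE; lra.
  have k0' : 0 < k%:R :> R by lra.
  have [S [U SU]] := vector_colouring_discrepancy n0 r0 k0' rE v1 vE'.
  by apply/bigcupP; exists (S, U) => //; rewrite inE rE.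
set b := #|_| in cover *; set N := #|_| in badle *.
have L0 : 0 <= L by lra.
have LeL : 0 <= L * expR L by rewrite mulr_ge0// expR_ge0.
have union : b%:R * (L * expR L) <= (2 ^+ n) ^+ 2 * N%:R.
  apply: (@le_trans _ _ (\sum_S \sum_U #|bad S U|%:R * (L * expR L))).
    under [leRHS]eq_bigr => S _ do rewrite -mulr_suml.
    rewrite -mulr_suml ler_wpM2r//.
    under eq_bigr => S _ do rewrite -natr_sum.
    by rewrite -natr_sum ler_nat.
  apply: (@le_trans _ _ (\sum_(S : {set 'I_n}) \sum_(U : {set 'I_n}) N%:R)).
    by apply: ler_sum => S _; apply: ler_sum => U _.
  have card2 : #|{set 'I_n}| = (2 ^ n)%N.
    by rewrite -cardsT -powersetT card_powerset cardsT card_ord.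
  by rewrite !sumr_const !card2 -mulrnA -[leLHS]mulr_natl natrM natrX expr2.
have two : (2 ^+ n) ^+ 2 <= expR (n%:R * 2%:R) :> R.
  have e1 : 2 <= expR 1 :> R by have := expR_ge1Dx (1 : R); lra.
  rewrite expRM_natr lerXn2r ?nnegrE ?expR_ge0 ?exprn_ge0//.
  by rewrite -[n%:R]mulr1 expRM_natl lerXn2r ?nnegrE ?expR_ge0.
have big : expR (n%:R * 2%:R) * expR n%:R <= L * expR L.
  rewrite -expRD -[leLHS]mul1r ler_pM// ?expR_ge0//; first by lra.
  by rewrite ler_expR; lra.
have N0 : 0 <= N%:R :> R by [].
have b0 : 0 <= b%:R :> R by [].
rewrite -(ler_pM2l (expR_gt0 (n%:R * 2%:R))) mulrCA.
apply: le_trans (ler_wpM2l b0 big) _; apply: le_trans union _.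
exact: ler_wpM2r.
Qed.

(** * Expected running time *)

Unset Implicit Arguments.
Set Strict Implicit.

Theorem theorem8 (R : realType) :
  exists c0 : R, 0 < c0 /\
  forall (k : nat) (r : nat -> nat) (T1 T2 : forall n, graph n -> R),
    (* c0 k^2 <= r(n) *)
    (forall n, c0 * (k%:R ^+ 2) <= (r n)%:R) ->
    (* r = o(n^{1/2}) *)
    (forall eps : R, 0 < eps ->
       exists N : nat, forall n, (N <= n)%N -> (r n)%:R <= eps * Num.sqrt (n%:R)) ->
    (* step (1) runs in polynomial time *)
    (exists (a : R) (d : nat), forall n (E : graph n),
       0 <= T1 n E <= a * (n.+1)%:R ^+ d) ->
    (* step (2) (Lawler's algorithm) runs in time o(exp(n)) *)
    (forall n (E : graph n), 0 <= T2 n E) ->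
    (forall eps : R, 0 < eps ->
       exists N : nat, forall n (E : graph n), (N <= n)%N -> T2 n E <= eps * expR (n%:R)) ->
    (* polynomial expected running time of Decide_k on G_{n,r(n)} *)
    exists (l : nat) (C : R) (N : nat), forall n, (N <= n)%N ->
      expect_reg (r n) (decide_time k T1 T2 (n := n)) <= C * (n%:R) ^+ l.
Proof.
exists (448 ^+ 2); split; first by rewrite exprn_gt0.
move=> k r T1 T2 kr ro [a [d T1le]] T2ge T2o.
have a0 : 0 <= a.
  by have := T1le 0%N finset.set0; rewrite expr1n mulr1 => /andP[]; exact: le_trans.
have [N2 T2le] := T2o 1 ltr01.
have [Nr rle] : exists N, forall n, (N <= n)%N -> (0 < k)%N ->
    8 * (r n)%:R <= (64 * k%:R)^-1 * n%:R :> R.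
  case: (posnP k) => [//|k0]; first by exists 0%N.
  (* The o(n^{1/2}) hypothesis is used with eps = delta / 8, together with sqrt n <= n. *)
  have d0 : 0 < (64 * k%:R)^-1 / 8 :> R by rewrite divr_gt0// invr_gt0 mulr_gt0// ltr0n.
  have [N hN] := ro _ d0; exists N => n /hN h _.
  have sqrt_le : Num.sqrt n%:R <= n%:R :> R.
    case: n {h} => [|n]; first by rewrite sqrtr0.
    rewrite -{2}(sqr_sqrtr (ler0n R n.+1)) expr2 ler_peMr ?sqrtr_ge0//.
    by rewrite -[leLHS]sqrtr1 ler_wsqrtr// ler1n.
  have := ler_wpM2l (ltW d0) sqrt_le; lra.
(* 2^d turns (n + 1)^d into a multiple of n^d; the summand 1 pays for the exact colouring step. *)
exists d, (a * 2 ^+ d + 1), (maxn 2 (maxn N2 Nr)) => n.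
rewrite !geq_max => /and3P[n2 nN2 nNr].
have n1 : 1 <= n%:R :> R by rewrite ler1n ltnW.
have nd1 : 1 <= n%:R ^+ d :> R by rewrite exprn_ege1.
have C0 : 0 <= (a * 2 ^+ d + 1) * n%:R ^+ d.
  by rewrite mulr_ge0 ?exprn_ge0// addr_ge0// mulr_ge0// exprn_ge0.
rewrite /expect_reg.
rewrite (_ : #|_| = #|[set E : graph n | regular (r n) E]|); last first.
  by apply: eq_card => E; rewrite !inE; apply/idP/idP; rewrite inE.
(* Without any r-regular graph the quotient is 0 by the convention for division by 0. *)
set M := #|_|; case: (posnP M) => [->|M0]; first by rewrite invr0 mulr0.
rewrite ler_pdivrMr ?ltr0n//.
have small : #|[set E : graph n | regular (r n) E & vec_chrom R E <= k%:R]|%:R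
    * expR n%:R <= M%:R :> R.
  have kr' : (448 * k%:R) ^+ 2 <= (r n)%:R :> R by rewrite exprMn.
  exact: (card_small_vec_chrom n2 kr' (rle n nNr)).
have step1 : \sum_(E : graph n | regular (r n) E) T1 n E <= a * 2 ^+ d * n%:R ^+ d * M%:R.
  rewrite -(mulrA a) -exprMn mulr_natr.
  have <- : \sum_(E : graph n | regular (r n) E) a * (2 * n%:R) ^+ d
      = (a * (2 * n%:R) ^+ d) *+ M.
    by rewrite -sumr_const; apply: eq_bigl => E; rewrite inE.
  apply: ler_sum => E _; have /andP[_ /le_trans ->//] := T1le n E.
  by rewrite ler_wpM2l// lerXn2r ?nnegrE ?mulr_ge0// -natr1; lra.
(* At most M exp(-n) graphs reach this step, each at cost at most exp n, so the total is at most
   M. *)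
have step2 : \sum_(E : graph n | regular (r n) E)
    (if k%:R < vec_chrom R E then 0 else T2 n E) <= n%:R ^+ d * M%:R.
  apply: (@le_trans _ _ M%:R); last by rewrite ler_peMl.
  apply: le_trans small; rewrite mulr_natl -sumr_const.
  rewrite big_mkcond [leRHS]big_mkcond/=; apply: ler_sum => E _.
  rewrite inE ltNge; case: (regular (r n) E) => //=; case: (vec_chrom R E <= k%:R) => //=.
  by have := T2le n E nN2; rewrite mul1r.
rewrite /decide_time big_split/= mulrDl mul1r mulrDl.
exact: lerD.
Qed.
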